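(* Let $\mathcal{P}$ be a class of probability measures on $(\Omega,\mathcal{F})=(\mathbb{R}^{\mathbb{N}},\mathcal{B}(\mathbb{R})^{\mathbb{N}})$ such that (a) $\mathbb{P}_1=\mathbb{P}_2=\cdots$ for all $\mathbb{P}\in\mathcal{P}$, (c) $\lim_{n\to\infty}\sup_{\mathbb{P}\in\mathcal{P}}\alpha_{\mathbb{P}}(n)=0$. Then, for every $\delta>0$, $$\lim_{n\to\infty}\ \sup_{\mathbb{P}\in\mathcal{P}}\ \mathbb{P}\bigl[d_{\text{Lévy}}(\widehat m_n,\mathbb{P}_1)\ge\delta\bigr]=0.$$
   Context: Here $X_i$ is the $i$th coordinate projection on $\Omega:=\mathbb{R}^{\mathbb{N}}$ (with product $\sigma$-field $\mathcal{F}$), and $\mathbb{P}_i:=\mathbb{P}\circ X_i^{-1}$ is the $i$th marginal distribution of a probability measure $\mathbb{P}$ on $(\Omega,\mathcal{F})$. The empirical probability measure is $\widehat m_n(x):=\frac1n\sum_{i=1}^n\delta_{x_i}$ for $x=(x_1,x_2,\ldots)\in\Omega$. The Lévy metric on probability measures on $(\mathbb{R},\mathcal{B}(\mathbb{R}))$ is $$d_{\text{Lévy}}(\mu,\nu):=\inf\{\varepsilon>0:F_\mu(x-\varepsilon)-\varepsilon\le F_\nu(x)\le F_\mu(x+\varepsilon)+\varepsilon\text{ for all }x\in\mathbb{R}\},$$ where $F_\mu,F_\nu$ are the distribution functions of $\mu,\nu$. The $n$th strong mixing coefficient of the coordinate process under $\mathbb{P}$ is $\alpha_{\mathbb{P}}(n):=\sup_{k\ge1}\sup_{A,B}|\mathbb{P}[A\cap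 B]-\mathbb{P}[A]\mathbb{P}[B]|$, where the inner supremum ranges over all $A\in\sigma(X_1,\ldots,X_k)$ and $B\in\sigma(X_{k+n},X_{k+n+1},\ldots)$. *)

(* Defs.v *)
From HB Require Import structures.
From mathcomp Require Import all_boot all_order all_algebra.
From mathcomp Require Import all_classical all_reals all_analysis.

Set Implicit Arguments.
Unset Strict Implicit.
Unset Printing Implicit Defensive.

Import Order.TTheory GRing.Theory Num.Theory.
Import numFieldNormedType.Exports.

Local Open Scope classical_set_scope.
Local Open Scope ring_scope.

(* Sequences are indexed from 0: [seqcoord i] is the projection usually written
   X_(i+1), and [marginal P i] is the distribution of X_(i+1) under P. *)

Definition seqspace (R : realType) : Type := nat -> R.

HB.instance Definition _ (R : realType) := Pointed.copy (seqspace R) (nat -> R).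

Definition seqcoord (R : realType) (i : nat) (x : seqspace R) : R := x i.

Definition sigma_coords (R : realType) (I : set nat) : set (set (seqspace R)) :=
  <<s \bigcup_(i in I) preimage_set_system setT (@seqcoord R i) measurable >>.

Definition seqspace_display : measure_display. Proof. exact: default_measure_display. Qed.

Section seqspace_measurable.
Variable R : realType.

Let sigma_coords_set0 : sigma_coords setT (set0 : set (seqspace R)).
Proof. exact: sigma_algebra0. Qed.

Let sigma_coords_setC (A : set (seqspace R)) :
  sigma_coords setT A -> sigma_coords setT (~` A).
Proof. exact: sigma_algebraC. Qed.

Let sigma_coords_bigcup (F : (set (seqspace R))^nat) :
  (forall i, sigma_coords setT (F i)) -> sigma_coords setT (\bigcup_i F i).
Proof. exact: sigma_algebra_bigcup. Qed.

HB.instance Definition _ := @isMeasurable.Build seqspace_display (seqspace R)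
  (sigma_coords setT) sigma_coords_set0 sigma_coords_setC sigma_coords_bigcup.

End seqspace_measurable.

Lemma measurable_seqcoord (R : realType) (i : nat) :
  measurable_fun [set: seqspace R] (@seqcoord R i).
Proof. by move=> _ B mB; apply: sub_sigma_algebra; exists i => //; exists B. Qed.

HB.instance Definition _ (R : realType) (i : nat) :=
  isMeasurableFun.Build _ _ (seqspace R) R (@seqcoord R i) (measurable_seqcoord i).

Definition marginal (R : realType) (P : probability (seqspace R) R) (i : nat) :
  probability R R := distribution P (@seqcoord R i).

(* [empirical 0 x] is the zero measure; [empirical n.+1 x] is a probability. *)
Definition empirical (R : realType) (n : nat) (x : seqspace R) :
    set R -> \bar R :=
  mscale (n%:R^-1)%:nng (msum (fun i => \d_(seqcoord i x)) n).

HB.instance Definition _ (R : realType) (n : nat) (x : seqspace R) :=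
  Measure.copy (empirical n x)
    (mscale (n%:R^-1)%:nng (msum (fun i => \d_(seqcoord i x)) n)).

Lemma empirical_setT (R : realType) (n : nat) (x : seqspace R) :
  empirical n.+1 x setT = 1%E.
Proof.
have sum1 : \sum_(i < n.+1) (\d_(seqcoord i x) [set: R] : \bar R) = n.+1%:R%:E.
  rewrite (eq_bigr (fun=> 1%E)) => [|i _]; last exact: diracT.
  by rewrite sumEFin sumr_const card_ord.
rewrite /empirical /mscale /= -[msum _ _ _]/(\sum_(i < n.+1) _)%E sum1.
by rewrite -EFinM mulVf.
Qed.

HB.instance Definition _ (R : realType) (n : nat) (x : seqspace R) :=
  Measure_isProbability.Build _ _ _ (empirical n.+1 x) (empirical_setT n x).

Definition distfun (R : realType) (mu : probability R R) (x : R) : R :=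
  fine (mu `]-oo, x]%classic).

Definition levy_dist (R : realType) (mu nu : probability R R) : R :=
  inf [set e | 0 < e /\ forall x,
    distfun mu (x - e) - e <= distfun nu x <= distfun mu (x + e) + e].

(* With 0-based coordinates, sigma(X_1, ..., X_k) is generated by the [seqcoord i]
   with i < k, and sigma(X_(k+n), X_(k+n+1), ...) by those with k + n <= i + 1. *)
Definition alpha_mixing (R : realType) (P : probability (seqspace R) R)
    (n : nat) : \bar R :=
  ereal_sup [set ereal_sup
      [set `|P (A `&` B) - P A * P B|%E
        | A in sigma_coords [set i | (i < k)%N]
        & B in sigma_coords [set i | (k + n <= i.+1)%N]]
    | k in [set k | (1 <= k)%N]].

(* Main.v *)
(* Chebyshev's inequality applied to the indicators of {X_i <= s}, whose covariances
   at distance at least N are at most sup alpha(N), shows that the empirical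
   distribution function at a point s is close to that of the marginal G, at a rate
   independent of the law P and of s.  No tightness of the marginals is available,
   but approximate quantiles t_j, with G(t_j - e) < j/K <= G(t_j), reduce Levy
   closeness to closeness at the 2K points t_j and t_j - e; these depend on P, but
   their number does not, so a union bound is uniform over the class. *)

Require Import Defs.
From mathcomp Require Import all_boot all_order all_algebra.
From mathcomp Require Import all_classical all_reals all_analysis.
From mathcomp Require Import measurable_realfun zify ring lra.

Set Implicit Arguments.
Unset Strict Implicit.
Unset Printing Implicit Defensive.

Import Order.TTheory GRing.Theory Num.Theory.
Import numFieldNormedType.Exports.

Local Open Scope classical_set_scope.
Local Open Scope ring_scope.

(** * Covariances of indicators and variances of finite sums *)

Section sums_of_indicators.
Context d (T : measurableType d) (R : realType) (P : probability T R).

Lemma Lfun2_indic (A : set T) : measurable A -> (\1_A : T -> R) \in Lfun P 2%:E.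
Proof.
move=> mA; rewrite inE/=; apply/andP; split; rewrite inE/=.
  exact: measurable_indic.
rewrite /finite_norm unlock poweR_lty//.
under eq_integral => x _ /=.
  rewrite (_ : `|\1_A x| `^ 2 = \1_A x :> R); last first.
    by rewrite indicE; case: (x \in A); rewrite ?normr1 ?powR1 ?normr0 ?powR0.
  over.
by rewrite integral_indic// (le_lt_trans (probability_le1 P _)) ?ltry// setIT.
Qed.

(** The quantity inside [alpha_mixing] is thus a covariance, which is how mixing enters a variance
    bound. *)
Lemma covariance_indic (A B : set T) : measurable A -> measurable B ->
  covariance P \1_A \1_B = (P (A `&` B) - P A * P B)%E.
Proof.
move=> mA mB.
have L1 C : measurable C -> (\1_C : T -> R) \in Lfun P 1.
  by move=> mC; rewrite Lfun_subset12 ?fin_num_measure ?Lfun2_indic.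
have mAB : measurable (A `&` B) by exact: measurableI.
rewrite covarianceE ?L1 //; last by rewrite -[_ * _]indicI L1.
by rewrite -[_ * _]indicI !expectation_indic.
Qed.

Lemma Lfun_sum (I : Type) (s : seq I) (X : I -> T -> R) :
  (forall i, X i \in Lfun P 2%:E) -> \sum_(i <- s) X i \in Lfun P 2%:E.
Proof. by move=> LX; apply: rpred_sum => *; [rewrite lee1n|exact: LX]. Qed.

Lemma covariance_suml (I : Type) (s : seq I) (X : I -> T -> R) (Y : T -> R) :
  (forall i, X i \in Lfun P 2%:E) -> Y \in Lfun P 2%:E ->
  covariance P (\sum_(i <- s) X i) Y = (\sum_(i <- s) covariance P (X i) Y)%E.
Proof.
move=> LX LY; elim: s => [|i s IH]; first by rewrite !big_nil covariance_cst_l.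
by rewrite !big_cons covarianceDl ?Lfun_sum// IH.
Qed.

Lemma variance_sum (I : Type) (s : seq I) (X : I -> T -> R) :
  (forall i, X i \in Lfun P 2%:E) ->
  ('V_P[(\sum_(i <- s) X i)%R] =
    \sum_(i <- s) \sum_(j <- s) covariance P (X i) (X j))%E.
Proof.
move=> LX; rewrite /variance covariance_suml ?Lfun_sum//.
apply: eq_bigr => i _; rewrite covarianceC covariance_suml//.
by apply: eq_bigr => j _; rewrite covarianceC.
Qed.
End sums_of_indicators.

(** Counts the indices too close to [i] for the mixing bound to apply; the count does not grow with
    [n]. *)
Lemma card_nat_near (N n i : nat) :
  (\sum_(j < n) ((i < j + N) && (j < i + N)) <= N.*2)%N.
Proof.
(* The relevant [j] form the interval from [i.+1 - N] up to, but excluding, [minn n (i + N)];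
   bounding by its length makes the induction on [n] go through. *)
suff: (\sum_(j < n) ((i < j + N) && (j < i + N)) <= minn n (i + N) - (i.+1 - N))%N.
  by lia.
elim: n => [|n IH]; first by rewrite big_ord0.
rewrite big_ord_recr/=; move: (\sum_(j < n) _)%N IH => S IH.
case: (ltnP i (n + N)) => ?; case: (ltnP n (i + N)) => ? /=; lia.
Qed.

(** * A quantitative weak law for indicators that are nearly uncorrelated at distance [N] *)

Section weak_law.
Context d (T : measurableType d) (R : realType) (P : probability T R).
Variables (A : nat -> set T) (p a : R) (N : nat).
Hypothesis mA : forall i, measurable (A i).
Hypothesis PA : forall i, P (A i) = p%:E.
Hypothesis a_ge0 : 0 <= a.
Hypothesis corA : forall i j, (i + N <= j)%N ->
  (`|P (A i `&` A j) - P (A i) * P (A j)| <= a%:E)%E.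

(** Pairs at distance at least [N] contribute at most [a], by [corA] and symmetry; the others are
    bounded by the trivial estimate 1. *)
Lemma covariance_indic_le (i j : nat) :
  (covariance P \1_(A i) \1_(A j) <=
    (a + ((i < j + N)%N && (j < i + N)%N)%:R)%:E)%E.
Proof.
rewrite covariance_indic//.
have [jNi|iNj] /= := leqP (j + N)%N i.
  rewrite addr0 setIC muleC; exact: le_trans (lee_abs _) (corA jNi).
have [iNj'|jNi] /= := leqP (i + N)%N j.
  rewrite addr0; exact: le_trans (lee_abs _) (corA iNj').
have mAA : measurable (A i `&` A j) by exact: measurableI.
apply: (@le_trans _ _ 1%E); last by rewrite lee_fin lerDr.
rewrite leeBlDr ?fin_numM ?fin_num_measure//.
by rewrite (le_trans (probability_le1 P mAA))// leeDl// mule_ge0.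
Qed.

Let X (i : nat) : T -> R := \1_(A i).
Let S (n : nat) : T -> R := \sum_(i < n) X i.

Let LX i : X i \in Lfun P 2%:E.
Proof. exact: Lfun2_indic. Qed.

Lemma expectation_sum_indic (n : nat) : ('E_P[S n] = (n%:R * p)%:E)%E.
Proof.
rewrite /S -(big_map (fun i : 'I_n => X i) xpredT id) expectation_sum; last first.
  by move=> _ /mapP[i _ ->]; rewrite Lfun_subset12// fin_num_measure.
rewrite big_map (eq_bigr (fun=> p%:E)) => [|i _]; last first.
  by rewrite expectation_indic// PA.
by rewrite sumEFin sumr_const card_ord mulr_natl.
Qed.

(** Each row of the covariance matrix sums to at most [n * a], plus 1 for each of the at most [2N]
    near indices. *)
Lemma variance_sum_indic_le (n : nat) :
  ('V_P[S n] <= (n%:R * (n%:R * a + N.*2%:R))%:E)%E.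
Proof.
rewrite variance_sum//.
have -> : n%:R * (n%:R * a + N.*2%:R) = \sum_(i < n) (n%:R * a + N.*2%:R) :> R.
  by rewrite sumr_const card_ord mulr_natl.
rewrite -sumEFin; apply: lee_sum => i _.
apply: le_trans; first by apply: lee_sum => j _; exact: covariance_indic_le.
rewrite sumEFin lee_fin big_split/= sumr_const card_ord -[a *+ n]mulr_natl lerD2l.
by rewrite -natr_sum ler_nat card_nat_near.
Qed.

(** Chebyshev's inequality for the sum of [m = n.+1] indicators at level [m * eta]: the variance
    bound is divided by [(m * eta) ^+ 2]. *)
Lemma weak_law_indic (eta : R) (n : nat) : 0 < eta ->
  (P [set x | (eta <= `|n.+1%:R^-1 * \sum_(i < n.+1) \1_(A i) x - p|)%R] <=
    (eta ^- 2 * (a + N.*2%:R / n.+1%:R))%:E)%E.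
Proof.
move=> eta0; set m := n.+1; have m0 : 0 < m%:R :> R by rewrite ltr0n.
have nM (u : R) : m%:R * `|u| = `|m%:R * u| by rewrite normrM gtr0_norm.
have mS : measurable_fun setT (S m).
  have := Lfun_sum (P := P) (index_enum 'I_m) (fun i : 'I_m => LX i).
  by move=> /andP[]; rewrite inE.
pose Y : {RV P >-> R} := mfun_Sub (mem_set mS).
have := @chebyshev _ _ _ P Y (m%:R * eta) (mulr_gt0 m0 eta0).
rewrite [X in fine X]expectation_sum_indic /=.
rewrite (_ : [set x | _ <= `|_ - m%:R * p|] =
  [set x | eta <= `|m%:R^-1 * \sum_(i < m) \1_(A i) x - p|]); last first.
  apply/funext => x /=; rewrite -[in RHS](ler_pM2l m0) /S fct_sumE.
  by rewrite nM mulrBr mulVKf ?lt0r_neq0.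
move=> /le_trans; apply.
have c0 : 0 < (m%:R * eta) ^- 2 by rewrite invr_gt0 exprn_gt0// mulr_gt0.
apply: (le_trans (lee_wpmul2l _ (variance_sum_indic_le m))).
  by rewrite lee_fin ltW.
rewrite -EFinM lee_fin le_eqVlt; apply/orP; left; apply/eqP.
field. by rewrite !lt0r_neq0.
Qed.
End weak_law.

(** * Lévy closeness from finitely many points, and countable descriptions of it *)

Definition levy_close (R : realType) (F G : R -> R) (e : R) :=
  forall x, F (x - e) - e <= G x <= F (x + e) + e.

Section levy_distance.
Variable R : realType.
Implicit Types mu nu : probability R R.

Lemma distfun_nondecreasing mu : {homo distfun mu : x y / x <= y}.
Proof.
move=> x y xy; apply: fine_le; rewrite ?fin_num_measure//.
by rewrite le_measure ?inE//; exact: subitvPr.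
Qed.

Lemma distfun_ge0 mu x : 0 <= distfun mu x.
Proof. exact: fine_ge0. Qed.

Lemma distfun_le1 mu x : distfun mu x <= 1.
Proof.
by rewrite -lee_fin fineK ?fin_num_measure// probability_le1.
Qed.

(** Choose [t] in the set where the distribution function is at least [p], less than [e] above its
    infimum; then [t - e] lies below the infimum. The limits 0 and 1 at the two infinities make the
    set bounded below and nonempty. *)
Lemma quantile_gap mu (e p : R) : 0 < e -> 0 < p < 1 ->
  exists t, p <= distfun mu t /\ distfun mu (t - e) < p.
Proof.
move=> e0 /andP[p0 p1].
(* The identity is a random variable with law [mu], so the limits known for [cdf] transfer to
   [distfun mu]. *)
pose X : {RV mu >-> R} := mfun_Sub (mem_set (@measurable_id _ R setT)).
have FE : fine \o cdf X = distfun mu by [].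
have : distfun mu @ +oo --> (1 : R) by rewrite -FE; exact/fine_cvg/cvg_cdfy1.
move=> /cvgr_gt /(_ _ p1) /filter_ex[u pu].
have : distfun mu @ -oo --> (0 : R) by rewrite -FE; exact/fine_cvg/cvg_cdfNy0.
move=> /cvgr_lt /(_ _ p0) /filter_ex[v vp].
pose S := [set t | p <= distfun mu t].
have lbS : has_lbound S.
  exists v => t /= pt; rewrite leNgt; apply/negP => /ltW/(distfun_nondecreasing mu).
  by move=> /(le_trans pt); rewrite leNgt vp.
have [|t pt ltt] := @inf_lt R S (inf S + e) (ex_intro _ u (ltW pu)).
  by rewrite ltrDl.
exists t; split => //; rewrite ltNge; apply/negP => pte.
by have := ge_inf lbS pte; rewrite leNgt ltrBlDr ltt.
Qed.

(** Round [G x] down to a level [j / K.+1]. Then [t j - e <= x <= t j.+1], so monotonicity compares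
    [F (x + e)] with [F (t j)] and [F (x - e)] with [F (t j.+1 - e)]. The loss is one level of the
    grid plus [eta]. *)
Lemma levy_close_grid (F G : R -> R) (e eta : R) (K : nat) (t : nat -> R) :
  {homo F : x y / x <= y} -> {homo G : x y / x <= y} ->
  (forall x, 0 <= F x <= 1) -> (forall x, 0 <= G x <= 1) ->
  0 <= eta -> K.+1%:R^-1 + eta <= e ->
  (forall j, (0 < j < K.+1)%N ->
    j%:R / K.+1%:R <= G (t j) /\ G (t j - e) < j%:R / K.+1%:R) ->
  (forall j, (0 < j < K.+1)%N -> `|F (t j) - G (t j)| <= eta /\
    `|F (t j - e) - G (t j - e)| <= eta) ->
  levy_close F G e.
Proof.
move=> Fh Gh F01 G01 eta0 Ke tG tF x.
set k := K.+1%:R^-1 in Ke tG; have k0 : 0 < K.+1%:R :> R by rewrite ltr0n.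
have /andP[G0 G1] := G01 x.
(* The cap at [K] matters only when [G x = 1], where truncation would give [K.+1]. *)
pose j := minn (Num.trunc (K.+1%:R * G x)) K.
have /andP[tl tu] := @truncn_itv _ (K.+1%:R * G x) (mulr_ge0 (ltW k0) G0).
have jK : (j <= K)%N by rewrite geq_minr.
have jG : j%:R * k <= G x.
  rewrite ler_pdivrMr// mulrC (le_trans _ tl)// ler_nat; exact: geq_minl.
have jeK : (K <= j)%N -> j = K by move=> Kj; apply/eqP; rewrite eqn_leq jK.
have Gj : (j < K)%N -> G x < j.+1%:R * k.
  move=> jltK; rewrite ltr_pdivlMr// mulrC (lt_le_trans tu)// ler_nat.
  by move: jltK; rewrite ltnS leq_min leqnn gtn_min ltnn orbF => /ltnW.
have kE : K.+1%:R * k = 1 by rewrite mulfV// lt0r_neq0.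
have Gj1 : G x <= j%:R * k + k.
  have [/Gj/ltW|] := ltnP j K; first by rewrite -natr1 mulrDl mul1r.
  move=> /jeK ->.
  by rewrite -[X in _ + X]mul1r -mulrDl natr1 kE.
have /andP[Fl0 Fl1] := F01 (x - e); have /andP[Fu0 Fu1] := F01 (x + e).
apply/andP; split.
  (* For [j = K] there is no point [t j.+1], but then [G x] is at least [1 - k], and [F <= 1]
     suffices. *)
  have [jltK|Kj] := ltnP j K; last first.
    by move: kE; rewrite -natr1 mulrDl mul1r -(jeK Kj) => kE; lra.
  have [tj tje] := tG j.+1 jltK; have [_] := tF j.+1 jltK.
  rewrite ler_norml => /andP[_].
  have xt : x <= t j.+1.
    rewrite leNgt; apply/negP => /ltW/Gh; have := Gj jltK; lra.
  have : F (x - e) <= F (t j.+1 - e) by apply: Fh; rewrite lerD2r.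
  by move: tje; rewrite -natr1 mulrDl mul1r; lra.
(* For [j = 0] there is no quantile to use, but then [G x <= k <= e]. *)
have [j0|j0] := posnP j; first by move: Gj1; rewrite j0 mul0r; lra.
have jj : (0 < j < K.+1)%N by rewrite j0.
have [tj tje] := tG j jj; have [+ _] := tF j jj.
rewrite ler_norml => /andP[+ _].
have tx : t j <= x + e.
  by rewrite leNgt; apply/negP; rewrite -ltrBrDr => /ltW/Gh; lra.
by have := Fh _ _ tx; lra.
Qed.

Lemma levy_close_le (F G : R -> R) (e e' : R) :
  {homo F : x y / x <= y} -> {homo G : x y / x <= y} ->
  e <= e' -> levy_close F G e -> levy_close F G e'.
Proof.
move=> Fh Gh ee FGe x; have /andP[l u] := FGe x.
have : F (x - e') <= F (x - e) by apply: Fh; lra.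
have : F (x + e) <= F (x + e') by apply: Fh; lra.
by move=> *; apply/andP; split; lra.
Qed.

(** Ensures that the infimum in [levy_dist] is taken over a nonempty set. *)
Lemma levy_close1 mu nu : levy_close (distfun mu) (distfun nu) 1.
Proof.
move=> x; have := distfun_ge0 mu (x + 1); have := distfun_le1 mu (x - 1).
have := distfun_ge0 nu x; have := distfun_le1 nu x.
by move=> *; apply/andP; split; lra.
Qed.

Lemma levy_dist_lt mu nu (delta : R) : levy_dist mu nu < delta <->
  exists e, [/\ 0 < e, e < delta & levy_close (distfun mu) (distfun nu) e].
Proof.
set S := [set e | 0 < e /\ levy_close (distfun mu) (distfun nu) e].
rewrite /levy_dist -[inf _]/(inf S); split.
  move=> /inf_lt[|e [e0 ce] ed]; first by exists 1; split => //; exact: levy_close1.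
  by exists e.
move=> [e [e0 ed ce]]; apply: le_lt_trans ed; apply: ge_inf => //.
by exists 0 => y [/ltW].
Qed.

(* Monotonicity lets the tolerance absorb the rounding of both [e] and [x] to
   rationals; hence events about [levy_dist] involve countably many conditions. *)
Lemma levy_dist_lt_rat mu nu (delta : R) : levy_dist mu nu < delta <->
  exists q : rat, 0 < (ratr q : R) < delta /\ forall y : rat,
    distfun mu (ratr y - ratr q) - ratr q <= distfun nu (ratr y) <=
      distfun mu (ratr y + ratr q) + ratr q.
Proof.
have muh := @distfun_nondecreasing mu; have nuh := @distfun_nondecreasing nu.
rewrite levy_dist_lt; split=> [[e [e0 ed ce]]|[q [/andP[q0 qd] cq]]].
  have [q /[!in_itv]/= /andP[eq qd]] := rat_in_itvoo ed.
  exists q; split=> [|y]; first by rewrite qd (lt_trans e0).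
  by have := levy_close_le muh nuh (ltW eq) ce (ratr y).
have [r /[!in_itv]/= /andP[qr rd]] := rat_in_itvoo qd.
exists (ratr r); split => //; first exact: lt_trans qr.
move=> x; apply/andP; split.
  have [y /[!in_itv]/= /andP[y1 y2]] :
      exists y : rat, ratr y \in `]x - (ratr r - ratr q), x[.
    by apply: rat_in_itvoo; lra.
  have /andP[+ _] := cq y; have := nuh _ _ (ltW y2).
  by have : distfun mu (x - ratr r) <= distfun mu (ratr y - ratr q); [apply: muh|]; lra.
have [y /[!in_itv]/= /andP[y1 y2]] :
    exists y : rat, ratr y \in `]x, x + (ratr r - ratr q)[.
  by apply: rat_in_itvoo; lra.
have /andP[_ +] := cq y; have := nuh _ _ (ltW y1).
by have : distfun mu (ratr y + ratr q) <= distfun mu (x + ratr r); [apply: muh|]; lra.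
Qed.

End levy_distance.

(** * Measurability of the deviation events, and mixing for pairs of coordinates *)

Section empirical_measure.
Variable R : realType.

Lemma distfun_empirical (n : nat) (x : seqspace R) (t : R) :
  distfun (empirical n.+1 x) t =
  n.+1%:R^-1 * \sum_(i < n.+1) \1_(seqcoord i @^-1` `]-oo, t]) x.
Proof.
rewrite /distfun /= /empirical /mscale /= -[msum _ _ _]/(\sum_(i < n.+1) _)%E.
by rewrite /dirac sumEFin -EFinM.
Qed.

Lemma measurable_seqcoord_preimage (i : nat) (B : set R) : measurable B ->
  measurable (seqcoord i @^-1` B : set (seqspace R)).
Proof. by move=> mB; rewrite -[X in measurable X]setTI; exact: measurable_seqcoord. Qed.

Lemma measurable_distfun_empirical (n : nat) (t : R) :
  measurable_fun setT (fun x : seqspace R => distfun (empirical n.+1 x) t).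
Proof.
under eq_fun do rewrite distfun_empirical.
apply: measurable_funM => //; apply: measurable_sum => i.
by apply: measurable_indic; exact: measurable_seqcoord_preimage.
Qed.

Lemma measurable_levy_dist_empirical (n : nat) (nu : probability R R) (delta : R) :
  measurable [set x : seqspace R | delta <= levy_dist (empirical n.+1 x) nu].
Proof.
pose C (q y : rat) := [set x : seqspace R |
  distfun (empirical n.+1 x) (ratr y - ratr q) - ratr q <= distfun nu (ratr y)
    <= distfun (empirical n.+1 x) (ratr y + ratr q) + ratr q].
have mC q y : measurable (C q y).
  rewrite -[C q y]setTI; apply: measurable_and => //; apply: measurable_fun_ler => //.
    apply: measurable_funB => //; exact: measurable_distfun_empirical.
  apply: measurable_funD => //; exact: measurable_distfun_empirical.
(* By [levy_dist_lt_rat], the complement is a union over rational [q] of intersections over rational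
   [y]; the intersection is written as the complement of a union. *)
have -> : [set x | delta <= levy_dist (empirical n.+1 x) nu] =
    ~` \bigcup_q (if 0 < (ratr q : R) < delta then ~` \bigcup_y ~` C q y else set0).
  apply/seteqP; split=> x /=.
    move=> dx [q _]; case: ifPn => // qd Cq; move: dx; rewrite leNgt => /negP; apply.
    apply/levy_dist_lt_rat; exists q; split => // y; apply: contrapT => Cqy.
    by apply: Cq; exists y.
  move=> nC; rewrite leNgt; apply/negP => /levy_dist_lt_rat[q [qd Cq]].
  apply: nC; exists q => //; rewrite qd => -[y _]; apply; exact: Cq.
apply/measurableC/bigcupT_measurable_rat => q; case: ifP => // _.
apply/measurableC/bigcupT_measurable_rat => y; exact: measurableC.
Qed.

Lemma le_alpha_mixing (P : probability (seqspace R) R) (n i j : nat) (B : set R) :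
  measurable B -> (i + n <= j)%N ->
  (`|P (seqcoord i @^-1` B `&` seqcoord j @^-1` B) -
     P (seqcoord i @^-1` B) * P (seqcoord j @^-1` B)| <= alpha_mixing P n)%E.
Proof.
move=> mB inj; apply: le_ereal_sup_tmp.
have sub (I : set nat) k : I k -> sigma_coords I (@seqcoord R k @^-1` B).
  by move=> Ik; apply: sub_sigma_algebra; exists k => //; exists B; rewrite ?setTI.
(* With [k = i.+1], coordinate [i] is the last one of the past, and [j] belongs to the future
   because [i.+1 + n <= j.+1]. *)
eexists; first by exists i.+1.
apply: ereal_sup_ubound; exists (@seqcoord R i @^-1` B); first by apply: sub; rewrite /= ltnSn.
exists (@seqcoord R j @^-1` B) => //; apply: sub.
by rewrite /= addSn ltnS.
Qed.

End empirical_measure.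

(** * Explicit deviation bounds for a single law *)

Section uniform_deviation.
Variables (R : realType) (P : probability (seqspace R) R) (N : nat) (a : R).
Hypothesis ident_marginals : forall (i : nat) (A : set R), measurable A ->
  marginal P i A = marginal P 0 A.
Hypothesis alpha_le : (alpha_mixing P N <= a%:E)%E.

(** The law enters the bound only through [a] and [N], and [s] does not enter it at all; hence the
    points [s] may later be chosen depending on [P]. *)
Lemma distfun_deviation_le (eta s : R) (n : nat) : 0 < eta -> 0 <= a ->
  (P [set x | (eta <=
      `|distfun (empirical n.+1 x) s - distfun (marginal P 0) s|)%R] <=
    (eta ^- 2 * (a + N.*2%:R / n.+1%:R))%:E)%E.
Proof.
move=> eta0 a0.
under eq_set do rewrite distfun_empirical.
apply: (weak_law_indic (A := fun i => seqcoord i @^-1` `]-oo, s])) => // [i|i|i j ij].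
- exact: measurable_seqcoord_preimage.
- rewrite fineK ?fin_num_measure//.
  by rewrite -[LHS]/(marginal P i `]-oo, s]%classic) ident_marginals.
- exact: le_trans (le_alpha_mixing P _ ij) alpha_le.
Qed.

(** A tolerance [delta / 4] goes to the grid of levels and another [delta / 4] to the pointwise
    deviations. This yields closeness at [delta / 2], strictly below [delta] as [levy_dist_lt]
    demands. *)
Lemma levy_deviation_le (delta : R) (K n : nat) :
  0 < delta -> 0 <= a -> K.+1%:R^-1 <= delta / 4 ->
  (P [set x | (delta <= levy_dist (empirical n.+1 x) (marginal P 0))%R] <=
    (K.+1.*2%:R * ((delta / 4) ^- 2 * (a + N.*2%:R / n.+1%:R)))%:E)%E.
Proof.
move=> delta0 a0 Kdelta; set c := _ ^- 2 * _; set nu := marginal P 0.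
have e0 : 0 < delta / 2 by lra.
have eta0 : 0 < delta / 4 by lra.
have [t tP] : {t : nat -> R & forall j, (0 < j < K.+1)%N ->
    j%:R / K.+1%:R <= distfun nu (t j) /\
    distfun nu (t j - delta / 2) < j%:R / K.+1%:R}.
  apply: (@choice _ _ (fun j u => (0 < j < K.+1)%N ->
    j%:R / K.+1%:R <= distfun nu u /\
    distfun nu (u - delta / 2) < j%:R / K.+1%:R)) => j.
  (* Outside the range of levels [t] takes the arbitrary value 0. *)
  have [/andP[j0 jK]|_] := boolP (0 < j < K.+1)%N; last by exists 0.
  have [|u uP] := @quantile_gap _ nu (delta / 2) (j%:R / K.+1%:R) e0.
    by rewrite divr_gt0 ?ltr0n//= ltr_pdivrMr ?ltr0n// mul1r ltr_nat.
  by exists u.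
pose D s := [set x | delta / 4 <= `|distfun (empirical n.+1 x) s - distfun nu s|].
have mD s : measurable (D s).
  rewrite -[D s]setTI; apply: measurable_fun_ler => //.
  apply: measurableT_comp => //; apply: measurable_funB => //.
  exact: measurable_distfun_empirical.
have PD s : (P (D s) <= c%:E)%E by exact: distfun_deviation_le.
pose E j := D (t j) `|` D (t j - delta / 2).
have mE j : measurable (E j) by exact: measurableU.
have PE j : (P (E j) <= (2 * c)%:E)%E.
  rewrite (le_trans (measureU2 _ (mD _) (mD _)))//.
  have -> : 2 * c = c + c by rewrite mulr_natl mulr2n.
  by rewrite EFinD; apply: leeD; exact: PD.
(* The union also includes [j = 0], which only enlarges it; hence the factor [2 * K.+1] in the
   bound. *)
have sub : [set x | delta <= levy_dist (empirical n.+1 x) nu] `<=`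
    \big[setU/set0]_(j < K.+1) E j.
  move=> x /=; apply: contraPP; rewrite -bigcup_mkord => nE.
  have De s (j : nat) : (j < K.+1)%N -> (D s `<=` E j) ->
      `|distfun (empirical n.+1 x) s - distfun nu s| <= delta / 4.
    move=> jK DE; rewrite leNgt; apply/negP => /ltW Ds.
    by apply: nE; exists j => //; exact: DE.
  suff ce : levy_close (distfun (empirical n.+1 x)) (distfun nu) (delta / 2).
    apply/negP; rewrite -ltNge; apply/levy_dist_lt; exists (delta / 2).
    by split => //; lra.
  apply: (levy_close_grid (eta := delta / 4) (K := K) (t := t)) => //.
  - exact: distfun_nondecreasing.
  - exact: distfun_nondecreasing.
  - by move=> y; rewrite distfun_ge0 distfun_le1.
  - by move=> y; rewrite distfun_ge0 distfun_le1.
  - exact: ltW.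
  - apply: le_trans (lerD Kdelta (lexx _)) _; lra.
  - move=> j /andP[_ jK]; split; apply: De jK _; rewrite /E.
    + exact: subsetUl.
    + exact: subsetUr.
apply: (le_trans (content_subadditive P _ _ sub)) => //.
  exact: measurable_levy_dist_empirical.
apply: (@le_trans _ _ (\sum_(j < K.+1) (2 * c)%:E)%E); first by apply: lee_sum => j _; exact: PE.
rewrite sumEFin sumr_const card_ord lee_fin -muln2 natrM -[_ *+ _]mulr_natl.
by rewrite mulrA.
Qed.

End uniform_deviation.

(** * Passage to the supremum over the class *)

Theorem corollary3p7 (R : realType) (PP : set (probability (seqspace R) R))
    (ident_marginals : forall P, PP P ->
       forall (i : nat) (A : set R), measurable A ->
         marginal P i A = marginal P 0%N A)
    (uniform_mixing :
       ereal_sup [set alpha_mixing P n | P in PP] @[n --> \oo] --> 0%E)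
    (delta : R) (delta_gt0 : 0 < delta) :
  ereal_sup [set P [set x : seqspace R |
                delta <= levy_dist (empirical n.+1 x) (marginal P 0%N)] | P in PP]
    @[n --> \oo] --> 0%E.
Proof.
pose sup_alpha n := ereal_sup [set alpha_mixing P n | P in PP].
have mixing_lt (a : R) : 0 < a ->
    exists N, forall P, PP P -> (alpha_mixing P N <= a%:E)%E.
  move=> a0; have a0E : (0 < a%:E :> \bar R)%E by rewrite lte_fin.
  have /filter_ex[N /= supN] : \forall n \near \oo, (sup_alpha n < a%:E)%E :=
    uniform_mixing _ (open_ereal_lt' a0E).
  exists N => P PPP; apply: le_trans (ltW supN).
  by apply: ereal_sup_ubound; exists P.
(* Over an empty class the supremum is minus infinity, which cannot tend to 0. A member of the class
   is what makes [sup_dev] nonnegative. *)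
have [P0 PPP0] : PP !=set0.
  apply/set0P/eqP => PP0.
  have N10 : ((-1)%:E < 0 :> \bar R)%E by rewrite lte_fin ltrN10.
  have /filter_ex[N] : \forall n \near \oo, ((-1)%:E < sup_alpha n)%E :=
    uniform_mixing _ (open_ereal_gt' N10).
  by rewrite /sup_alpha PP0 image_set0 ereal_sup0.
pose sup_dev n := ereal_sup [set P [set x : seqspace R |
  delta <= levy_dist (empirical n.+1 x) (marginal P 0%N)] | P in PP].
have eventually_le (eps : R) : 0 < eps ->
    \forall n \near \oo, (sup_dev n <= eps%:E)%E.
  move=> eps0.
  pose K := Num.trunc (4 / delta).
  have KE : K.+1%:R^-1 <= delta / 4.
    rewrite -[delta / 4]invrK lef_pV2 ?posrE ?invr_gt0 ?divr_gt0 ?ltr0n//.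
    by rewrite invf_div ltW// truncnS_gt.
  pose b : R := K.+1.*2%:R * (delta / 4) ^- 2.
  have b0 : 0 < b by rewrite mulr_gt0 ?ltr0n// invr_gt0 exprn_gt0// divr_gt0.
  (* The deviation bound reads [b * (a + 2N / n.+1)]; this [a] gives each term half of [eps] once
     [n >= 2N / a]. Since [N] depends only on [a], that threshold is the same for all laws. *)
  pose a := eps / (2 * b).
  have a0 : 0 < a by rewrite divr_gt0// mulr_gt0.
  have [N mixN] := mixing_lt a a0.
  near=> n.
  apply: ge_ereal_sup => _ [P PPP <-].
  apply: le_trans (levy_deviation_le (ident_marginals P PPP) (mixN P PPP) n
    delta_gt0 (ltW a0) KE) _.
  rewrite lee_fin mulrA -/b.
  have -> : eps = b * (a + a) by rewrite /a; field; rewrite lt0r_neq0.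
  rewrite ler_pM2l// lerD2l ler_pdivrMr ?ltr0n// mulrC -ler_pdivrMr//.
  rewrite -natr1 ler_wpDr//.
  by near: n; exact: nbhs_infty_ger.
have sup_ge0 n : (0 <= sup_dev n)%E.
  apply: le_ereal_sup_tmp; eexists; first by exists P0.
  by [].
have fin_sup (eps : R) (u : \bar R) : (0 <= u -> u <= eps%:E -> u \is a fin_num)%E.
  by move=> u0 ueps; rewrite ge0_fin_numE// (le_lt_trans ueps)// ltry.
(* Convergence in the extended reals splits into eventual finiteness, obtained from the bounds 0 and
   1, and convergence of the real parts. *)
rewrite -[X in X @ _]/sup_dev; apply/fine_cvgP; split.
  near=> n; apply: (fin_sup 1) => //.
  by near: n; exact: eventually_le.
apply/cvgrPdist_le => eps eps0; near=> n => /=.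
have un : (sup_dev n <= eps%:E)%E.
  by near: n; exact: eventually_le.
rewrite sub0r normrN ger0_norm ?fine_ge0// -lee_fin fineK//.
exact: (fin_sup eps).
Unshelve. all: by end_near.
Qed.
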